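(* Let $n, d, r, k$ be positive integers with $r \le d$ and $k \le d$. Let $\mathbf{F}_d \in \mathbb{R}^{d\times n}$ be the discrete linear parameter-to-observable map at all $d$ candidate sensor locations, let $\mathbf{\Gamma}_{\mathrm{pr}} \in \mathbb{R}^{n\times n}$ be the (symmetric positive definite) discrete prior covariance, and let $\mathbf{\Gamma}_{\mathrm{n}}^d = \operatorname{diag}(\sigma_1^2,\dots,\sigma_d^2)$ with all $\sigma_j^2>0$ be the noise covariance at the candidate locations. Set $$\hat{\mathbf{F}}_d = (\mathbf{\Gamma}_{\mathrm{n}}^d)^{-1/2}\mathbf{F}_d, \qquad \mathbf{H}_d = \hat{\mathbf{F}}_d\, \mathbf{\Gamma}_{\mathrm{pr}}\, \hat{\mathbf{F}}_d^T \in \mathbb{R}^{d\times d}.$$ Let $\lambda_1 \ge \lambda_2 \ge \cdots \ge \lambda_d$ be the eigenvalues of $\mathbf{H}_d$, counted with multiplicity, and let $$\hat{\mathbf{H}}_d = U_k \Sigma_k U_k^T$$ be the rank-$k$ truncation of its eigendecomposition, where $\Sigma_k = \operatorname{diag}(\lambda_1,\dots,\lambda_k)$ and the columns of $U_k\in\mathbb{R}^{d\times k}$ are corresponding orthonormal eigenvectors of $\mathbf{H}_d$. For a design matrix $W \in \mathcal{W}$, let $\Psi(W)$ be the discrete expected information gain, and define the approximate expected information gain $$\hat{\Psi}(W) = \frac12 \log\det\left(\mathbf{I}_{r\times r} + W \hat{\mathbf{H}}_d W^T\right).$$ Then for every $W \in \mathcal{W}$, $$0 \le \Psi(W) - \hat{\Psi}(W)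 \le \frac12 \sum_{i=k+1}^{d} \log(1+\lambda_i).$$
   Context: The set of design matrices, which select $r$ distinct sensors among $d$ candidates, is $$\mathcal{W} = \left\{ W \in \mathbb{R}^{r\times d} : W_{ij}\in\{0,1\},\ \sum_{j=1}^d W_{ij} = 1 \text{ for every } i,\ \sum_{i=1}^r W_{ij} \in \{0,1\} \text{ for every } j \right\},$$ where $W_{ij}=1$ means that the $i$-th sensor is placed at the $j$-th candidate location. Setting: a linear Bayesian inverse problem with discrete parameter $\mathbf{m}\in\mathbb{R}^n$, Gaussian prior with covariance $\mathbf{\Gamma}_{\mathrm{pr}}$ (symmetric positive definite), and data $\mathbf{y} = \mathbf{F}\mathbf{m} + \epsilon$ with Gaussian noise $\epsilon\sim\mathcal{N}(0,\mathbf{\Gamma}_{\mathrm{n}})$. The observation noises at different candidate locations are uncorrelated, with variance $\sigma_j^2$ at the $j$-th location. For a design $W\in\mathcal{W}$, the parameter-to-observable map is $\mathbf{F} = W\mathbf{F}_d \in \mathbb{R}^{r\times n}$, and the noise covariance is that of the selected sensors, $\mathbf{\Gamma}_{\mathrm{n}} = W \mathbf{\Gamma}_{\mathrm{n}}^d W^T \in \mathbb{R}^{r\times r}$. The discrete expected information gain of the design $W$ is $$\Psi(W) = \frac12 \log\det\left(\mathbf{I}_{n\times n} + \mathbf{\Gamma}_{\mathrm{pr}}^{1/2}\, \mathbf{F}^T \mathbf{\Gamma}_{\mathrm{n}}^{-1} \mathbf{F}\, \mathbf{\Gamma}_{\mathrm{pr}}^{1/2}\right), \qquad \mathbf{F}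 = W\mathbf{F}_d,\quad \mathbf{\Gamma}_{\mathrm{n}} = W\mathbf{\Gamma}_{\mathrm{n}}^d W^T.$$ Here $\log$ is the natural logarithm, $\mathbf{I}$ denotes an identity matrix, matrix square roots are the symmetric positive definite ones, and an empty sum is $0$. *)

(* Defs.v *)
From HB Require Import structures.
From mathcomp Require Import all_boot all_order all_algebra.
From mathcomp Require Import sesquilinear.
From mathcomp Require Import boolp classical_sets reals exp.
Set Implicit Arguments.
Unset Strict Implicit.
Unset Printing Implicit Defensive.
Import Order.TTheory GRing.Theory Num.Theory.
Local Open Scope classical_set_scope.
Local Open Scope ring_scope.

Definition design_matrices {R : realType} (r d : nat) : set 'M[R]_(r, d) :=
  [set W | [/\ forall i j, W i j = 0 \/ W i j = 1,
               forall i, \sum_(j < d) W i j = 1 &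
               forall j, \sum_(i < r) W i j = 0 \/ \sum_(i < r) W i j = 1]].

Definition spd {R : realType} (n : nat) (A : 'M[R]_n) : Prop :=
  A \is symmetricmx /\ forall x : 'cV[R]_n, x != 0 -> 0 < (x^T *m A *m x) 0 0.

(* The symmetric positive definite square root, which exists and is unique when
   A is symmetric positive definite; otherwise the value is the junk 0. *)
Definition sqrtmx {R : realType} (n : nat) (A : 'M[R]_n) : 'M[R]_n :=
  xget 0 [set S : 'M[R]_n | spd S /\ S *m S = A].

Definition information_gain {R : realType} (n d r : nat) (Fd : 'M[R]_(d, n))
    (Gpr : 'M[R]_n) (Gnd : 'M[R]_d) (W : 'M[R]_(r, d)) : R :=
  let F := W *m Fd in
  let Gn := W *m Gnd *m W^T in
  2^-1 * ln (\det (1%:M + sqrtmx Gpr *m F^T *m invmx Gn *m F *m sqrtmx Gpr)).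

Definition approx_information_gain {R : realType} (d r : nat)
    (Hhat : 'M[R]_d) (W : 'M[R]_(r, d)) : R :=
  2^-1 * ln (\det (1%:M + W *m Hhat *m W^T)).

Definition noise_covariance {R : realType} (d : nat) (sigma : 'I_d -> R) :
  'M[R]_d := diag_mx (\row_j sigma j ^+ 2).

Definition whitened_map {R : realType} (n d : nat) (Fd : 'M[R]_(d, n))
    (Gnd : 'M[R]_d) : 'M[R]_(d, n) := invmx (sqrtmx Gnd) *m Fd.

Definition data_space_hessian {R : realType} (n d : nat) (Fd : 'M[R]_(d, n))
    (Gpr : 'M[R]_n) (Gnd : 'M[R]_d) : 'M[R]_d :=
  let Fhat := whitened_map Fd Gnd in Fhat *m Gpr *m Fhat^T.

(* lambda 0 >= ... >= lambda (d-1), with multiplicities counted algebraically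
   (for symmetric H these agree with the geometric ones). *)
Definition ordered_eigenvalues {R : realType} (d : nat) (H : 'M[R]_d)
    (lambda : 'I_d -> R) : Prop :=
  (forall i j : 'I_d, (i <= j)%N -> lambda j <= lambda i) /\
  char_poly H = \prod_(i < d) ('X - (lambda i)%:P).

Definition leading {R : realType} (d k : nat) (hk : (k <= d)%N)
    (lambda : 'I_d -> R) : 'rV[R]_k := \row_j lambda (widen_ord hk j).

Definition orthonormal_eigenvectors {R : realType} (d k : nat) (H : 'M[R]_d)
    (mu : 'rV[R]_k) (U : 'M[R]_(d, k)) : Prop :=
  U^T *m U = 1%:M /\ forall j, H *m col j U = mu 0 j *: col j U.

Definition truncation {R : realType} (d k : nat) (mu : 'rV[R]_k)
    (U : 'M[R]_(d, k)) : 'M[R]_d := U *m diag_mx mu *m U^T.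

(* Main.v *)
(* Write H = Hhat + E for the truncated eigendecomposition.  Then
   E = (1 - U U^T) H (1 - U U^T)^T is a Gram matrix Y Y^T with Hhat E = 0, so
   1 + H = (1 + Hhat) (1 + E) and det (1 + E) is the product of the discarded
   1 + lambda_i.  A design has orthonormal rows and commutes with diagonal
   weights, hence Psi W = 1/2 ln det (1 + W H W^T).  With M = 1 + W Hhat W^T,
     det (1 + W H W^T) = det (M + W Y (W Y)^T)
                       = det M * det (1 + Y^T (W^T M^-1 W) Y),
   where 0 <= W^T M^-1 W <= 1 in the Loewner order, so the last factor lies
   between 1 and det (1 + Y^T Y) = det (1 + E). *)
Require Import Defs.
From HB Require Import structures.
From mathcomp Require Import all_boot all_order all_algebra.
From mathcomp Require Import sesquilinear spectral complex.
From mathcomp Require Import boolp classical_sets reals exp.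
Import Order.TTheory GRing.Theory Num.Theory.
Local Open Scope ring_scope.
Set Implicit Arguments.
Unset Strict Implicit.
Unset Printing Implicit Defensive.

(** * Determinant swap, real diagonalization and interpolation *)

Lemma det_1DmulmxC (R : comNzRingType) m n (A : 'M[R]_(m, n)) (B : 'M[R]_(n, m)) :
  \det (1%:M + A *m B) = \det (1%:M + B *m A).
Proof.
(* One block matrix is factored into triangular blocks in two ways; comparing determinants gives the
   swap. *)
have E1 : block_mx 1%:M (- A) B 1%:M
  = block_mx 1%:M 0 B 1%:M *m block_mx 1%:M (- A) 0 (1%:M + B *m A).
  by rewrite mulmx_block !mul1mx !mul0mx !mulmx1 !addr0 mulmxN addrCA addNr addr0.
have E2 : block_mx 1%:M (- A) B 1%:M
  = block_mx (1%:M + A *m B) (- A) 0 1%:M *m block_mx 1%:M 0 B 1%:M.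
  by rewrite mulmx_block !mul1mx !mulmx1 !mul0mx ?mulmx0 !add0r mulNmx addrK.
have := congr1 determinant E1; rewrite E2 !det_mulmx !det_ublock !det_lblock.
by rewrite !det1 !mul1r !mulr1.
Qed.

Lemma symmetricmxP (R : fieldType) n (A : 'M[R]_n) :
  reflect (A^T = A) (A \is symmetricmx).
Proof.
by apply: (iffP (is_hermitianmxP _ _ _)); rewrite expr0 scale1r map_mx_id.
Qed.

(* The complex spectral theorem gives a similarity over R[i] to a real diagonal
   matrix; two real matrices similar over R[i] are similar over R. *)
Lemma symmetric_diagonalization (R : rcfType) n (A : 'M[R]_n) : A^T = A ->
  exists P (d : 'rV[R]_n), P \in unitmx /\ P *m A = diag_mx d *m P.
Proof.
move=> symA; pose f := real_complex R.
have real_f m (B : 'M[R]_(m, n)) : map_mx f B \is a realmx.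
  by apply/mxOverP => i j; rewrite mxE /f /= complex_real.
have fRe m (B : 'M[R[i]]_(m, n)) : B \is a realmx ->
    B = map_mx f (map_mx (@complex.Re R) B).
  move=> /mxOverP Breal; apply/matrixP => i j.
  by rewrite 2!mxE; apply/esym/RRe_real/Breal.
have symfA : map_mx f A \is symmetricmx by apply/symmetricmxP; rewrite map_trmx symA.
have /orthomx_spectralP := symmetric_normalmx symfA (real_f _ A).
have := hermitian_spectral_diag_real (realsym_hermsym symfA (real_f _ A)).
have := spectral_unit (map_mx f A).
move: (spectralmx _) (spectral_diag _) => P d Pu dreal AE.
have : similar_in unitmx (map_mx f A) (diag_mx d).
  by exists P => //; apply/similarP => //; rewrite AE !mulmxA mulmxV // mul1mx.
move/real_similar.
rewrite (fRe _ d dreal) -map_diag_mx => /(_ (real_f _ _) (real_f _ _))[Q].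
rewrite inE => /andP[Qreal Qu] /(similarP Qu).
move: Qu; rewrite (fRe _ Q Qreal) map_unitmx -!map_mxM => Qu /map_mx_inj QE.
by exists (map_mx (@complex.Re R) Q), (map_mx (@complex.Re R) d).
Qed.

(** Lets a function of the eigenvalues be realized as a polynomial in the matrix. A new node [a] is
    fitted by adding a multiple of [q], which vanishes at the old nodes but not at [a]. *)
Lemma interpolation (F : fieldType) (f : F -> F) (s : seq F) :
  exists p : {poly F}, {in s, forall x, p.[x] = f x}.
Proof.
elim: s => [|a s [p pE]]; first by exists 0.
case: (boolP (a \in s)) => [a_s|a_s].
  by exists p => x; rewrite inE => /predU1P[->|]; apply: pE.
pose q := \prod_(b <- s) ('X - b%:P).
have qa : q.[a] != 0.
  by rewrite -/(root q a) root_prod_XsubC.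
exists (p + ((f a - p.[a]) / q.[a])%:P * q) => x.
rewrite inE hornerD hornerCM => /predU1P[->|x_s]; first by rewrite divfK // addrC subrK.
have /rootP -> : root q x by rewrite root_prod_XsubC.
by rewrite mulr0 addr0 pE.
Qed.

(** * Positive semidefinite and positive definite matrices *)

Section PositiveSemidefinite.
Variable R : realType.

Definition psd n (A : 'M[R]_n) : Prop :=
  A^T = A /\ forall x : 'cV[R]_n, 0 <= (x^T *m A *m x) 0 0.

Lemma sqnormE n (x : 'cV[R]_n) : (x^T *m x) 0 0 = \sum_i x i 0 ^+ 2.
Proof. by rewrite mxE; apply: eq_bigr => i _; rewrite mxE expr2. Qed.

Lemma sqnorm_ge0 n (x : 'cV[R]_n) : 0 <= (x^T *m x) 0 0.
Proof. by rewrite sqnormE sumr_ge0 // => i _; apply: sqr_ge0. Qed.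

Lemma sqnorm_gt0 n (x : 'cV[R]_n) : x != 0 -> 0 < (x^T *m x) 0 0.
Proof.
rewrite lt0r sqnorm_ge0 andbT; apply: contra_neq; rewrite sqnormE.
move/eqP; rewrite psumr_eq0 => [/allP x0|i _]; last exact: sqr_ge0.
apply/matrixP => i j; rewrite ord1 mxE; apply/eqP.
by rewrite -sqrf_eq0; apply: (x0 i); exact: mem_index_enum.
Qed.

Lemma psd_congr m n (A : 'M[R]_m) (X : 'M[R]_(m, n)) :
  psd A -> psd (X^T *m A *m X).
Proof.
move=> [symA posA]; split; first by rewrite !trmx_mul trmxK symA mulmxA.
by move=> x; have := posA (X *m x); rewrite trmx_mul !mulmxA.
Qed.

Lemma psdD n (A B : 'M[R]_n) : psd A -> psd B -> psd (A + B).
Proof.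
move=> [symA posA] [symB posB]; split; first by rewrite linearD /= symA symB.
by move=> x; rewrite mulmxDr mulmxDl mxE addr_ge0.
Qed.

Lemma spd_psd n (A : 'M[R]_n) : spd A -> psd A.
Proof.
move=> [/symmetricmxP symA posA]; split=> // x.
by have [->|/posA/ltW//] := eqVneq x 0; rewrite mulmx0 mxE.
Qed.

Lemma psd1 n : psd (1%:M : 'M[R]_n).
Proof. by split=> [|x]; rewrite ?trmx1 // mulmx1 sqnorm_ge0. Qed.

Lemma spd1 n : spd (1%:M : 'M[R]_n).
Proof.
split=> [|x]; first by apply/symmetricmxP; rewrite trmx1.
by rewrite mulmx1; exact: sqnorm_gt0.
Qed.

Lemma psd_gram m n (X : 'M[R]_(m, n)) : psd (X^T *m X).
Proof. by have := psd_congr X (psd1 m); rewrite mulmx1. Qed.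

Lemma psd_diag n (d : 'rV[R]_n) : (forall i, 0 <= d 0 i) -> psd (diag_mx d).
Proof.
move=> d0; split=> [|x]; first exact: tr_diag_mx.
rewrite mul_mx_diag mxE sumr_ge0 // => i _; rewrite !mxE mulrAC mulr_ge0 // -expr2.
exact: sqr_ge0.
Qed.

Lemma spdDpsd n (A B : 'M[R]_n) : spd A -> psd B -> spd (A + B).
Proof.
move=> [/symmetricmxP symA posA] [symB posB]; split.
  by apply/symmetricmxP; rewrite linearD /= symA symB.
by move=> x x0; rewrite mulmxDr mulmxDl mxE ltr_wpDr // posA.
Qed.

Lemma spd_unitmx n (A : 'M[R]_n) : spd A -> A \in unitmx.
Proof.
move=> [/symmetricmxP symA posA]; rewrite -row_free_unit -kermx_eq0.
apply/eqP/row_matrixP => i; rewrite row0; apply/eqP/negPn/negP => v0.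
have := posA (row i (kermx A))^T; rewrite trmx_eq0 trmxK -row_mul mulmx_ker row0.
by move=> /(_ v0); rewrite mul0mx mxE ltxx.
Qed.

(** The inverse of [A] is the congruence of [A] by its own symmetric inverse. *)
Lemma psd_inv n (A : 'M[R]_n) : spd A -> psd (invmx A).
Proof.
move=> spdA; have [symA posA] := spd_psd spdA.
have := psd_congr (invmx A) (conj symA posA).
by rewrite trmx_inv symA mulVmx ?spd_unitmx // mul1mx.
Qed.

(** Row [i] of [P] is a nonzero left eigenvector, on which the quadratic form equals [d 0 i] times a
    positive squared norm. Orthogonality of [P] is not assumed. *)
Lemma psd_diag_ge0 n (A P : 'M[R]_n) (d : 'rV[R]_n) :
  psd A -> P \in unitmx -> P *m A = diag_mx d *m P -> forall i, 0 <= d 0 i.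
Proof.
move=> [_ posA] Pu PA i.
have v0 : (row i P)^T != 0.
  rewrite trmx_eq0; apply: contraTneq Pu => /(congr1 (mulmx^~ (invmx P))) ri0.
  apply/negP => Pu; move: ri0; rewrite -row_mul mulmxV // mul0mx.
  by move/matrixP/(_ 0 i)/eqP; rewrite !mxE eqxx oner_eq0.
have := posA (row i P)^T.
rewrite trmxK -row_mul PA row_mul row_diag_mx -scalemxAl -rowE -scalemxAl mxE.
by rewrite pmulr_lge0 // -[X in X *m _]trmxK sqnorm_gt0.
Qed.

Lemma spd_diag_gt0 n (A P : 'M[R]_n) (d : 'rV[R]_n) :
  spd A -> P \in unitmx -> P *m A = diag_mx d *m P -> forall i, 0 < d 0 i.
Proof.
move=> spdA Pu PA i; rewrite lt0r (psd_diag_ge0 (spd_psd spdA) Pu PA) andbT.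
have : diag_mx d \in unitmx.
  suff -> : diag_mx d = P *m A *m invmx P.
    by rewrite !unitmx_mul unitmx_inv Pu spd_unitmx.
  by rewrite PA mulmxK.
rewrite unitmxE det_diag unitfE prodf_seq_neq0 => /allP/(_ i).
by rewrite mem_index_enum; apply.
Qed.

(** By similarity the determinant is a product of factors [1 + d 0 i], each at least 1. *)
Lemma det_1Dpsd_ge1 n (A : 'M[R]_n) : psd A -> 1 <= \det (1%:M + A).
Proof.
move=> psdA; have [P [d [Pu PA]]] := symmetric_diagonalization psdA.1.
have -> : 1%:M + A = invmx P *m (1%:M + diag_mx d) *m P.
  by rewrite mulmxDr mulmx1 mulmxDl mulVmx // -mulmxA -PA mulKmx.
rewrite !det_mulmx mulrAC -det_mulmx mulVmx // det1 mul1r -diag_const_mx -linearD.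
rewrite det_diag; elim/big_ind: _ => // [x y x1 y1|i _].
  by rewrite -[1]mulr1 ler_pM.
by rewrite !mxE lerDl (psd_diag_ge0 psdA Pu PA).
Qed.

(** * The positive definite square root *)

Lemma spd_sqr n (S : 'M[R]_n) : S^T = S -> S \in unitmx -> spd (S *m S).
Proof.
move=> symS Su; split; first by apply/symmetricmxP; rewrite trmx_mul symS.
move=> x x0; rewrite mulmxA -{1}symS -trmx_mul -mulmxA sqnorm_gt0 //.
apply: contraNneq x0 => /(congr1 (mulmx (invmx S))).
by rewrite mulKmx // mulmx0 => ->.
Qed.

Lemma spd_sqrt_exists n (A : 'M[R]_n) : spd A -> exists S, spd S /\ S *m S = A.
Proof.
(* Size 0 is treated apart: the polynomial calculus below takes place in the nonzero ring of square
   matrices of positive size. *)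
move=> spdA; case: n A spdA => [A _|n A spdA].
  by exists 1%:M; split; [exact: spd1|rewrite !thinmx0].
have psdA := spd_psd spdA.
have [P [d [Pu PA]]] := symmetric_diagonalization psdA.1.
have d0 := spd_diag_gt0 spdA Pu PA.
have [p pE] := interpolation (fun x => Num.sqrt (Num.sqrt x))
  [seq d 0 i | i <- enum 'I_n.+1].
(* Q is the fourth root of A; as a polynomial in A it is symmetric, although the
   diagonalizing matrix P need not be orthogonal. *)
pose Q := horner_mx A p.
have AE : A = P^-1 *m diag_mx d *m P^-1^-1.
  by rewrite invrK -mulmxA -PA mulKmx.
have QE : Q = P^-1 *m diag_mx (map_mx (horner p) d) *m P^-1^-1.
  by rewrite -horner_mx_diag -horner_mx_uconj ?unitrV // -AE.
have symQ : Q^T = Q.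
  rewrite /Q; elim/poly_ind: (p) => [|q c IH]; first by rewrite !rmorph0 trmx0.
  rewrite rmorphD rmorphM /= horner_mx_C horner_mx_X linearD /= tr_scalar_mx.
  rewrite trmx_mul IH psdA.1; congr (_ + _).
  exact: (comm_mx_horner q (erefl (A *m A))).
have Qu : Q \in unitmx.
  rewrite QE !unitmx_mul !unitmx_inv Pu andbT /= unitmxE det_diag unitfE.
  apply/prodf_neq0 => i _; rewrite mxE pE; last by rewrite map_f // mem_enum.
  by rewrite !sqrtr_eq0 -!ltNge ?sqrtr_gt0 d0.
exists (Q *m Q); split; first exact: spd_sqr.
have -> : Q *m Q *m (Q *m Q) = horner_mx A (p * p * (p * p)) by rewrite !rmorphM.
rewrite [in LHS]AE horner_mx_uconj ?unitrV // horner_mx_diag [RHS]AE.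
congr (_ *m diag_mx _ *m _); apply/rowP => i; rewrite mxE !hornerM pE;
  last by rewrite map_f // mem_enum.
by rewrite -!expr2 !sqr_sqrtr ?sqrtr_ge0 // ltW.
Qed.

Lemma psd_diag_entry_ge0 n (A : 'M[R]_n) i : psd A -> 0 <= A i i.
Proof.
by move=> [_ /(_ (delta_mx i 0))]; rewrite trmx_delta -rowE -colE !mxE.
Qed.


Lemma spd_sqrt_unique n (S T : 'M[R]_n) : spd S -> spd T -> S *m S = T *m T -> S = T.
Proof.
move=> spdS spdT ST; pose D := S - T.
have symD : D^T = D by rewrite /D linearB /= (spd_psd spdS).1 (spd_psd spdT).1.
(* S D + D T = S^2 - T^2 = 0, and the trace turns this into a vanishing sum of
   two nonnegative terms. *)
have trSD : \tr (D^T *m S *m D) + \tr (D^T *m T *m D) = 0.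
  rewrite symD [\tr (D *m T *m D)]mxtrace_mulC.
  rewrite -!mulmxA -linearD -mulmxDr /=.
  have -> : S *m D + D *m T = 0 by rewrite mulmxBr mulmxBl ST addrA subrK subrr.
  by rewrite mulmx0 mxtrace0.
apply/eqP; rewrite -subr_eq0 -/D; apply/eqP/matrixP => i j; rewrite [RHS]mxE.
suff Dj0 : col j D = 0 by have /matrixP/(_ i 0) := Dj0; rewrite !mxE.
(* A nonzero column [j] of [D] makes the [j]-th diagonal entry of [D^T S D] positive, and every
   other diagonal entry in the two traces is nonnegative. *)
apply/eqP/negPn/negP => Dj0; move/eqP: trSD; apply/negP; rewrite gt_eqF //.
have psdS := psd_congr D (spd_psd spdS); have psdT := psd_congr D (spd_psd spdT).
apply: ltr_wpDr; first by apply: sumr_ge0 => k _; exact: psd_diag_entry_ge0.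
rewrite /mxtrace (bigD1 j) //= ltr_wpDr //.
  by apply: sumr_ge0 => k _; exact: psd_diag_entry_ge0.
have := spdS.2 (col j D) Dj0; rewrite tr_col -row_mul colE mulmxA -colE -row_mul.
by rewrite !mxE.
Qed.

Lemma sqrtmxP n (A : 'M[R]_n) : spd A -> spd (sqrtmx A) /\ sqrtmx A *m sqrtmx A = A.
Proof.
move=> /spd_sqrt_exists[S hS].
exact: (xgetI (P := [set S : 'M[R]_n | spd S /\ S *m S = A]%classic) 0 hS).
Qed.

(** Uniqueness turns the choice made in [sqrtmx] into a computation: exhibiting one positive
    definite root suffices. *)
Lemma sqrtmx_eq n (A S : 'M[R]_n) : spd S -> S *m S = A -> sqrtmx A = S.
Proof.
move=> spdS SA; have /sqrtmxP[spdT TA] : spd A.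
  by rewrite -SA; apply: spd_sqr; [exact: (spd_psd spdS).1|exact: spd_unitmx].
by apply: spd_sqrt_unique => //; rewrite SA.
Qed.

(** * Determinants and the Loewner order *)

Lemma det_spd_gt0 n (A : 'M[R]_n) : spd A -> 0 < \det A.
Proof.
move=> /spd_sqrt_exists[S [spdS <-]]; rewrite det_mulmx -expr2 lt0r sqr_ge0 andbT.
by rewrite sqrf_eq0 -unitfE -unitmxE spd_unitmx.
Qed.

(** Factoring the positive definite root of [A] out on both sides reduces the claim to a determinant
    of the form [1 + psd], which is at least 1. *)
Lemma det_leDpsd n (A B : 'M[R]_n) : spd A -> psd B -> \det A <= \det (A + B).
Proof.
move=> spdA psdB; have [S [spdS SA]] := spd_sqrt_exists spdA.
have Su := spd_unitmx spdS; have symS := (spd_psd spdS).1.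
have -> : A + B = S *m (1%:M + (invmx S)^T *m B *m invmx S) *m S.
  rewrite trmx_inv symS mulmxDr mulmx1 mulmxDl SA; congr (_ + _).
  by rewrite !mulmxA mulmxV // mul1mx mulmxKV.
rewrite !det_mulmx mulrAC -det_mulmx SA ler_peMr //; first exact/ltW/det_spd_gt0.
exact/det_1Dpsd_ge1/psd_congr.
Qed.

(** With [M = 1 + B], the difference is [M^-1 (B + B^2) M^-1], a congruence of a sum of two positive
    semidefinite matrices. *)
Lemma psd_1B_inv n (B : 'M[R]_n) : psd B -> psd (1%:M - invmx (1%:M + B)).
Proof.
move=> psdB; have spdM := spdDpsd (spd1 n) psdB.
set M := 1%:M + B in spdM *; have Mu := spd_unitmx spdM.
have symM := (spd_psd spdM).1.
have -> : 1%:M - invmx M = (invmx M)^T *m (B + B^T *m B) *m invmx M.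
  have -> : B + B^T *m B = M *m B by rewrite psdB.1 mulmxDl mul1mx.
  have BE : B = M - 1%:M by rewrite addrC addKr.
  by rewrite trmx_inv symM mulmxA mulVmx // mul1mx BE mulmxBl mulmxV // mul1mx.
exact/psd_congr/psdD/psd_gram.
Qed.

(** The difference splits as [(1 - W^T W) + W^T (1 - Mi) W]. Since [W W^T = 1], the first term is an
    orthogonal projection and hence its own Gram matrix. *)
Lemma psd_1B_compress_inv n r (W : 'M[R]_(r, n)) (H : 'M[R]_n) :
  W *m W^T = 1%:M -> psd H ->
  psd (1%:M - W^T *m invmx (1%:M + W *m H *m W^T) *m W).
Proof.
move=> WW psdH.
have psdB : psd (W *m H *m W^T) by rewrite -{1}[W]trmxK; exact: psd_congr.
set Mi := invmx _.
have -> : 1%:M - W^T *m Mi *m W = (1%:M - W^T *m W)^T *m (1%:M - W^T *m W)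
          + W^T *m (1%:M - Mi) *m W.
  rewrite [(_ - _)^T]linearB /= trmx1 trmx_mul trmxK mulmxBl mul1mx mulmxBr mulmx1.
  rewrite mulmxA -[_ *m W^T]mulmxA WW mulmx1 subrr subr0.
  by rewrite mulmxBr mulmx1 mulmxBl addrA subrK.
apply: psdD; first exact: psd_gram.
exact/psd_congr/psd_1B_inv.
Qed.

Lemma det_compression_bounds n m r (W : 'M[R]_(r, n)) (H : 'M[R]_n) (Y : 'M[R]_(n, m)) :
  W *m W^T = 1%:M -> psd H ->
  let D := \det (1%:M + W *m H *m W^T) in
  let D' := \det (1%:M + W *m (H + Y *m Y^T) *m W^T) in
  [/\ 0 < D, D <= D' & D' <= D * \det (1%:M + Y *m Y^T)].
Proof.
move=> WW psdH D D'.
have psdB : psd (W *m H *m W^T) by rewrite -{1}[W]trmxK; exact: psd_congr.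
have spdM := spdDpsd (spd1 r) psdB.
set M := 1%:M + _ in spdM; have Mu := spd_unitmx spdM.
have D'E : D' = \det (M + (W *m Y) *m (W *m Y)^T).
  by rewrite /D' /M mulmxDr mulmxDl addrA trmx_mul !mulmxA.
split; first exact: det_spd_gt0.
  by rewrite D'E det_leDpsd // -{1}[W *m Y]trmxK; exact: psd_gram.
(* [M] is factored out on the left and the remaining rank update is swapped by [det_1DmulmxC]. *)
have -> : D' = D * \det (1%:M + Y^T *m (W^T *m invmx M *m W) *m Y).
  have -> : Y^T *m (W^T *m invmx M *m W) *m Y = (W *m Y)^T *m (invmx M *m (W *m Y)).
    by rewrite trmx_mul !mulmxA.
  rewrite -det_1DmulmxC D'E -det_mulmx -/M mulmxDr mulmx1 !mulmxA.
  by rewrite mulmxV // mul1mx.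
(* Swapping [1 + Y Y^T] into [1 + Y^T Y] gives both determinants size [m]; the two matrices then
   differ by [Y^T (1 - W^T M^-1 W) Y]. *)
rewrite ler_pM2l ?det_spd_gt0 // [X in _ <= X]det_1DmulmxC.
have -> : 1%:M + Y^T *m Y = 1%:M + Y^T *m (W^T *m invmx M *m W) *m Y
     + Y^T *m (1%:M - W^T *m invmx M *m W) *m Y.
  by rewrite mulmxBr mulmx1 mulmxBl -addrA [X in _ = _ + X]addrC subrK.
apply: det_leDpsd; last exact/psd_congr/psd_1B_compress_inv.
apply: spdDpsd; first exact: spd1.
exact/psd_congr/psd_congr/psd_inv.
Qed.

End PositiveSemidefinite.

(** * Orthogonality relations of design matrices *)

(** Two entries equal to 1 would push the sum to at least 2. This is applied to the columns and to
    the rows of a design. *)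
Lemma indicator_sum_le1 (R : numDomainType) (I : finType) (f : I -> R) :
  (forall i, f i = 0 \/ f i = 1) -> \sum_i f i <= 1 ->
  forall i j, i != j -> f i * f j = 0.
Proof.
move=> f01 f1 i j neq_ij; have f0 l : 0 <= f l by case: (f01 l) => ->.
case: (f01 i) (f01 j) => [->|fi] [->|fj]; rewrite ?mul0r ?mulr0 //.
move: f1; rewrite (bigD1 i) //= (bigD1 j) 1?eq_sym //= fi fj gerDl.
by rewrite lt_geF // ltr_wpDr ?sumr_ge0.
Qed.

Section Design.
Variables (R : realType) (r d : nat) (W : 'M[R]_(r, d)).
Hypothesis designW : design_matrices W.

Lemma design_mul_tr : W *m W^T = 1%:M.
Proof.
have [W01 row1 col01] := designW.
apply/matrixP => i j; rewrite !mxE; have [->|neq_ij] := eqVneq i j.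
  rewrite -[RHS](row1 j); apply: eq_bigr => l _; rewrite mxE.
  by case: (W01 j l) => ->; rewrite ?mul0r ?mulr1.
rewrite big1 // => l _; rewrite mxE.
apply: (indicator_sum_le1 (f := W^~ l)) neq_ij => //.
by case: (col01 l) => ->.
Qed.

(** Each row has a single 1, so products of distinct entries of a row vanish. Diagonality lets
    [W^T W] commute with the diagonal noise weights. *)
Lemma design_tr_mul_diag : exists e, W^T *m W = diag_mx e.
Proof.
have [W01 row1 _] := designW.
exists (\row_j (W^T *m W) j j); apply/matrixP => i j; rewrite [RHS]mxE.
have [->|neq_ij] := eqVneq i j; first by rewrite mulr1n [RHS]mxE.
rewrite mulr0n mxE big1 // => l _; rewrite mxE.
by apply: (indicator_sum_le1 (f := W l)) neq_ij => //; rewrite row1.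
Qed.

End Design.

(** * The information gain in whitened data space *)

Lemma spd_diag (R : realType) n (e : 'rV[R]_n) :
  (forall j, 0 < e 0 j) -> spd (diag_mx e).
Proof.
move=> e0; split; first by apply/symmetricmxP; rewrite tr_diag_mx.
move=> x x0; rewrite lt0r (psd_diag (fun i => ltW (e0 i))).2 andbT.
apply: contra_neq x0 => /eqP; rewrite mul_mx_diag mxE psumr_eq0; last first.
  by move=> i _; rewrite !mxE mulrAC mulr_ge0 ?(ltW (e0 i)) // -expr2 sqr_ge0.
move=> /allP x0; apply/matrixP => i j; rewrite ord1 mxE.
have := x0 i (mem_index_enum _); rewrite !mxE mulrAC -expr2 mulf_eq0 sqrf_eq0.
by rewrite (gt_eqF (e0 i)) orbF => /eqP.
Qed.

(** The root has entries [|sigma j|], because positivity of [sigma j ^+ 2] leaves the sign of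
    [sigma j] free. *)
Lemma sqrtmx_noise_covariance (R : realType) d (sigma : 'I_d -> R) :
  (forall j, 0 < sigma j ^+ 2) ->
  let T := diag_mx (\row_j `|sigma j|) in
  [/\ spd T, T *m T = noise_covariance sigma & sqrtmx (noise_covariance sigma) = T].
Proof.
move=> sigma0 T; have spdT : spd T.
  apply: spd_diag => j; rewrite mxE normr_gt0.
  by apply: contraTneq (sigma0 j) => ->; rewrite expr0n ltxx.
have TT : T *m T = noise_covariance sigma.
  rewrite mulmx_diag; congr diag_mx; apply/rowP => j.
  by rewrite !mxE -expr2 real_normK ?num_real.
by split=> //; exact: sqrtmx_eq.
Qed.

Lemma information_gainE (R : realType) (n d r : nat) (Fd : 'M[R]_(d, n)) (Gpr : 'M[R]_n)
    (sigma : 'I_d -> R) (W : 'M[R]_(r, d)) :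
  spd Gpr -> (forall j, 0 < sigma j ^+ 2) -> design_matrices W ->
  information_gain Fd Gpr (noise_covariance sigma) W =
  2^-1 * ln (\det (1%:M +
    W *m data_space_hessian Fd Gpr (noise_covariance sigma) *m W^T)).
Proof.
move=> spdG sigma0 designW; rewrite /information_gain /data_space_hessian /whitened_map.
have [spdT TT ->] := sqrtmx_noise_covariance sigma0.
set T := diag_mx _ in spdT TT *; have Tu := spd_unitmx spdT.
have WW := design_mul_tr designW; have [e WtW] := design_tr_mul_diag designW.
have [_] := sqrtmxP spdG; set S := sqrtmx Gpr => SS.
have symS : S^T = S by exact: (spd_psd (sqrtmxP spdG).1).1.
(* [V] is the inverse root of the selected noise covariance; the facts needed are that [V V] inverts
   that covariance and that [V W = W T^-1], so whitening commutes with selection. *)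
pose V := W *m invmx T *m W^T.
(* [W^T W] is diagonal, so it moves past [T] and is absorbed by [W W^T = 1]. *)
have TVW : W *m T = W *m T *m W^T *m W.
  by rewrite -[RHS]mulmxA WtW -mulmxA diag_mxC -WtW !mulmxA WW mul1mx.
have TrV : W *m T *m W^T *m V = 1%:M.
  by rewrite /V !mulmxA -TVW mulmxK.
have VTr : V *m (W *m T *m W^T) = 1%:M by exact: mulmx1C.
have VW : V *m W = W *m invmx T.
  rewrite -[V *m W](mulmxK Tu) -[V *m W *m T]mulmxA TVW [V *m _]mulmxA VTr mul1mx //.
have symV : V^T = V.
  by rewrite /V !trmx_mul trmxK trmx_inv (spd_psd spdT).1 mulmxA.
clearbody V; have -> : invmx (W *m noise_covariance sigma *m W^T) = V *m V.
  have GV : (W *m noise_covariance sigma *m W^T) *m (V *m V) = 1%:M.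
    have -> : W *m noise_covariance sigma *m W^T = (W *m T *m W^T) *m (W *m T *m W^T).
      by rewrite -TT !mulmxA -TVW.
    by rewrite -(mulmxA _ _ (V *m V)) (mulmxA _ V V) TrV mul1mx.
  have [Gu _] := mulmx1_unit GV.
  by rewrite -[LHS]mulmx1 -GV mulKmx.
congr (_ * ln _).
(* This grouping is a product of an [n] by [r] and an [r] by [n] matrix; the determinant swap then
   passes from parameter space to data space. *)
have -> : S *m (W *m Fd)^T *m (V *m V) *m (W *m Fd) *m S
        = (S *m (W *m Fd)^T *m V) *m (V *m (W *m Fd) *m S) by rewrite !mulmxA.
rewrite det_1DmulmxC; congr (\det (_ + _)).
rewrite -SS !trmx_mul trmx_inv (spd_psd spdT).1 !mulmxA VW.
have WV : W^T *m V = invmx T *m W^T.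
  by rewrite -{1}symV -trmx_mul VW trmx_mul trmx_inv (spd_psd spdT).1.
by rewrite -!mulmxA WV.
Qed.

(** * Eigenvalues and deflation *)

Section Eigenvalues.
Variables (R : realType) (d : nat) (H : 'M[R]_d) (lambda : 'I_d -> R).
Hypothesis charH : char_poly H = \prod_(i < d) ('X - (lambda i)%:P).

(** The characteristic polynomial at -1 is [det (-1 - H)]; the factor [(-1)^d] appears on both sides
    and cancels. *)
Lemma det_1D_eigenvalues : \det (1%:M + H) = \prod_(i < d) (1 + lambda i).
Proof.
have sgn (x : R) : (-1) ^+ d * ((-1) ^+ d * x) = x.
  by rewrite mulrA -exprMn mulrNN mulr1 expr1n mul1r.
apply: (can_inj sgn).
rewrite -detZ scaleN1r.
have -> : (-1) ^+ d = \prod_(i < d) (-1 : R) by rewrite prodr_const card_ord.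
rewrite -big_split /=.
have := congr1 (horner_eval (-1)) charH.
rewrite /char_poly -det_map_mx /= rmorph_prod /= => detE.
transitivity (\det (map_mx (horner_eval (-1)) (char_poly_mx H))).
  congr (\det _); apply/matrixP => i j.
  by rewrite !mxE /horner_eval !hornerE hornerMn hornerX opprD mulNrn.
rewrite detE; apply: eq_bigr => i _.
by rewrite /horner_eval hornerXsubC mulN1r opprD.
Qed.

Lemma psd_eigenvalue_ge0 : psd H -> forall i, 0 <= lambda i.
Proof.
move=> [_ posH] i.
have : eigenvalue H (lambda i).
  rewrite eigenvalue_root_char charH; apply/rootP.
  by rewrite horner_prod (bigD1 i) //= hornerXsubC subrr mul0r.
move/eigenvalueP=> [v vH v0]; have := posH v^T.
rewrite trmxK vH -scalemxAl mxE pmulr_lge0 // -{1}[v]trmxK.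
by rewrite sqnorm_gt0 // trmx_eq0.
Qed.

End Eigenvalues.

Lemma orthonormal_eigenvectors_mul (R : realType) d k (H : 'M[R]_d) (mu : 'rV[R]_k) U :
  orthonormal_eigenvectors H mu U -> H *m U = U *m diag_mx mu.
Proof.
move=> [_ eigU]; apply/matrixP => i j; have /matrixP/(_ i 0) := eigU j.
by rewrite mul_mx_diag colE mulmxA -!colE !mxE mulrC.
Qed.

Section Deflation.
Variables (R : comNzRingType) (d k : nat).
Variables (H : 'M[R]_d) (U : 'M[R]_(d, k)) (mu : 'rV[R]_k).
Hypotheses (symH : H^T = H) (UU : U^T *m U = 1%:M) (HU : H *m U = U *m diag_mx mu).

Let UH : U^T *m H = diag_mx mu *m U^T.
Proof. by rewrite -[LHS]trmxK trmx_mul trmxK symH HU trmx_mul tr_diag_mx. Qed.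

(** Projecting [H] on the left already removes [U diag(mu) U^T], and the remainder annihilates [U],
    so projecting on the right changes nothing. The sandwiched form makes the remainder a Gram
    matrix as soon as [H] is one. *)
Lemma deflationE :
  H - U *m diag_mx mu *m U^T = (1%:M - U *m U^T) *m H *m (1%:M - U *m U^T)^T.
Proof.
rewrite [(_ - _)^T]linearB /= trmx1 trmx_mul trmxK mulmxBl mul1mx -(mulmxA U _ H) UH.
rewrite mulmxBr mulmx1 mulmxBl !mulmxA HU -[_ *m U^T *m U]mulmxA UU mulmx1.
by rewrite subrr subr0.
Qed.

(** With [K = U diag(mu) U^T], the relation [K H = K K] gives [(1 + K) (1 + (H - K)) = 1 + H]. *)
Lemma det_1D_deflation :
  \det (1%:M + H) = \prod_j (1 + mu 0 j) * \det (1%:M + (H - U *m diag_mx mu *m U^T)).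
Proof.
have <- : \det (1%:M + U *m diag_mx mu *m U^T) = \prod_j (1 + mu 0 j).
  rewrite -mulmxA det_1DmulmxC -mulmxA UU mulmx1 -diag_const_mx -linearD det_diag.
  by apply: eq_bigr => j _; rewrite !mxE.
rewrite -det_mulmx; congr (\det _); set K := U *m _ *m _.
rewrite mulmxDl mul1mx mulmxDr mulmx1 mulmxBr.
have -> : K *m H = K *m K.
  by rewrite /K -!mulmxA UH (mulmxA U^T) UU mul1mx.
by rewrite subrr addr0 -addrA subrK.
Qed.

End Deflation.

(** * Logarithms and the error bound *)

Lemma ln_prod (R : realType) (I : Type) (s : seq I) (P : pred I) (f : I -> R) :
  (forall i, 0 < f i) -> ln (\prod_(i <- s | P i) f i) = \sum_(i <- s | P i) ln (f i).
Proof.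
move=> f0; suff [] : 0 < \prod_(i <- s | P i) f i /\
  ln (\prod_(i <- s | P i) f i) = \sum_(i <- s | P i) ln (f i) by [].
elim/big_rec2: _ => [|i x y _ [y0 yE]]; first by rewrite ln1 ltr01.
by rewrite mulr_gt0 // lnM ?posrE // yE.
Qed.

Theorem theorem3p3 (R : realType) (n d r k : nat)
    (hn : (0 < n)%N) (hd : (0 < d)%N) (hr : (0 < r)%N) (hk : (0 < k)%N)
    (hrd : (r <= d)%N) (hkd : (k <= d)%N)
    (Fd : 'M[R]_(d, n)) (Gpr : 'M[R]_n) (hGpr : spd Gpr)
    (sigma : 'I_d -> R) (hsigma : forall j, 0 < sigma j ^+ 2)
    (lambda : 'I_d -> R) (Uk : 'M[R]_(d, k)) :
  let Gnd := noise_covariance sigma in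
  let Hd := data_space_hessian Fd Gpr Gnd in
  let muk := leading hkd lambda in
  let Hhat := truncation muk Uk in
  ordered_eigenvalues Hd lambda ->
  orthonormal_eigenvectors Hd muk Uk ->
  forall W : 'M[R]_(r, d), design_matrices W ->
    0 <= information_gain Fd Gpr Gnd W - approx_information_gain Hhat W /\
    information_gain Fd Gpr Gnd W - approx_information_gain Hhat W
      <= 2^-1 * \sum_(i < d | (k <= i)%N) ln (1 + lambda i).
Proof.
move=> Gnd Hd muk Hhat [_ charH] [UU eigU] W designW.
rewrite information_gainE // /approx_information_gain -/Gnd -/Hd.
have [spdS SS] := sqrtmxP hGpr; have symS := (spd_psd spdS).1.
pose X := whitened_map Fd Gnd *m sqrtmx Gpr.
have HE : Hd = X *m X^T by rewrite trmx_mul symS mulmxA -[X *m _]mulmxA SS.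
clearbody X; have psdH : psd Hd by rewrite HE -{1}[X]trmxK; exact: psd_gram.
have lambda0 := psd_eigenvalue_ge0 charH psdH.
have HU := orthonormal_eigenvectors_mul (conj UU eigU).
(* Deflating [Hd = X X^T] leaves the Gram matrix of the projected factor. *)
pose Y := (1%:M - Uk *m Uk^T) *m X.
have HhatE : Hd = Hhat + Y *m Y^T.
  have := deflationE psdH.1 UU HU; rewrite -[Uk *m _ *m _]/Hhat => E.
  rewrite -[LHS](subrK Hhat) E addrC; congr (_ + _).
  by rewrite HE /Y trmx_mul !mulmxA.
have psdHhat : psd Hhat.
  rewrite /Hhat /truncation -{1}[Uk]trmxK; apply: psd_congr; apply: psd_diag => j.
  by rewrite mxE.
have lambda1 i : 0 < 1 + lambda i by rewrite ltr_pwDl.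
(* Two factorizations of [det (1 + Hd)] are compared and the nonzero product over the leading [k]
   eigenvalues is cancelled. Indices start at 0, so [k <= i] selects exactly the discarded
   eigenvalues. *)
have detY : \det (1%:M + Y *m Y^T) = \prod_(i < d | (k <= i)%N) (1 + lambda i).
  have := det_1D_deflation psdH.1 UU HU; rewrite -[Uk *m _ *m _]/Hhat.
  rewrite {2}HhatE [Hhat + _]addrC addrK (det_1D_eigenvalues charH).
  rewrite (bigID (fun i : 'I_d => (i < k)%N)) /= (big_ord_narrow hkd) /=.
  rewrite [X in _ = X * _](eq_bigr (fun j => 1 + lambda (widen_ord hkd j))); last first.
    by move=> j _; rewrite mxE.
  rewrite [X in _ * X = _](eq_bigl (fun i : 'I_d => (k <= i)%N));
    last by move=> i /=; rewrite -leqNgt.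
  by move/mulfI => -> //; rewrite gt_eqF // prodr_gt0.
have := det_compression_bounds Y (design_mul_tr designW) psdHhat.
rewrite -HhatE detY /=; set D := \det _; set D' := \det _ => -[D0 DD' D'D].
have prod0 : 0 < \prod_(i < d | (k <= i)%N) (1 + lambda i) by exact: prodr_gt0.
have D'0 := lt_le_trans D0 DD'.
rewrite -mulrBr; split.
  by rewrite mulr_ge0 ?invr_ge0 ?ler0n // subr_ge0 ler_ln ?posrE.
rewrite ler_pM2l ?invr_gt0 ?ltr0n // lerBlDl -ln_prod // -lnM ?posrE //.
by rewrite ler_ln ?posrE // mulr_gt0.
Qed.
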